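(* Let $x$ and $y$ be normal infinite words over a finite alphabet $A$. If $x$ and $y$ are finite-state independent, then their join $x\vee y$ is normal.
   Context: For $x=a_1a_2\cdots$ and $y=b_1b_2\cdots$ the join is $x\vee y=a_1b_1a_2b_2\cdots$. For words $w,u$, the number of aligned occurrences $|w|_u^{al}$ is $|\{i: w[i..i+|u|-1]=u,\ i\equiv 1 \bmod |u|\}|$ (positions start at 1). An infinite word $x$ is normal if for every $\ell\ge1$ and every $u\in A^\ell$, $\lim_{n\to\infty}|x[1..n]|^{al}_u/(n/\ell)=|A|^{-\ell}$. A $k$-automaton is a tuple $\langle Q,A,\delta,I\rangle$ with finite state set $Q$, transition relation $\delta\subseteq Q\times(A\cup\{\varepsilon\})^k\times Q$ and set $I$ of initial states; an infinite run is accepting if it starts in an initial state and all $k$ components of its label (componentwise concatenation of transition labels) are infinite. It is $\ell$-deterministic if $I$ is a singleton and for any two transitions leaving the same state $p$ with labels $(\alpha_1,\dots,\alpha_k)$, $(\alpha'_1,\dots,\alpha'_k)$: $\alpha_j=\varepsilon$ for some $j\le\ell$ implies $\alpha'_j=\varepsilon$, and $\alpha_i=\alpha'_i$ for all $i\le\ell$ implies equality of the remaining label components and of target states; it then realizes a partial function from the first $\ell$ tapes to the last $k-\ell$. For a $1$-deterministic $2$-automaton $\mathcal T$ and $x=a_1a_2\cdots$ with accepting run $q_0\xrightarrow{a_1|v_1}q_1\xrightarrow{a_2|v_2}\cdots$, $\rho_{\mathcal T}(x)=\liminf_n|v_1\cdots v_n|/n$; $\rho(x)$ is the infimum over one-to-one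 (injective) such $\mathcal T$. A compressor is a $2$-deterministic $3$-automaton $\mathcal C$ with input tapes $x$ and oracle $y$ such that $x\mapsto\mathcal C(x,y)$ is injective for each fixed $y$; with accepting run $q_0\xrightarrow{\alpha_1,\beta_1|w_1}q_1\cdots$, $\rho_{\mathcal C}(x/y)=\liminf_n|w_1\cdots w_n|/|\alpha_1\cdots\alpha_n|$, and $\rho(x/y)$ is the infimum over compressors. $x,y$ are finite-state independent if $\rho(x/y)=\rho(x)$, $\rho(y/x)=\rho(y)$ and $\rho(x),\rho(y)$ are nonzero. *)

(* Defs.v *)
From HB Require Import structures.
From mathcomp Require Import all_boot all_order all_algebra.
From mathcomp Require Import all_classical all_reals.
From mathcomp Require Import ereal topology normedtype sequences.
Set Implicit Arguments. Unset Strict Implicit. Unset Printing Implicit Defensive.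
Import Order.TTheory GRing.Theory Num.Theory numFieldNormedType.Exports.
Local Open Scope ring_scope.
Local Open Scope classical_set_scope.

(** Infinite words over a finite alphabet A are maps nat -> A
    (position i here = position i+1 in the paper). *)
Definition iword (A : Type) := nat -> A.

Definition join (A : Type) (x y : iword A) : iword A :=
  fun n => if odd n then y n./2 else x n./2.

(** the finite factor x[i+1 .. i+l] (paper's 1-based indexing) *)
Definition factor (A : Type) (x : iword A) (i l : nat) : seq A :=
  mkseq (fun j => x (i + j)) l.

(** |x[1..n]|^al_u : aligned occurrences of u in the prefix of length n
    (0-based start i with i = 0 mod |u|, i.e. 1-based start = 1 mod |u|) *)
Definition al_count (A : eqType) (x : iword A) (u : seq A) (n : nat) : nat :=
  #|[set i : 'I_n | [&& (i %% size u == 0)%N, (i + size u <= n)%N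
                        & factor x i (size u) == u]]|.

Definition normal (R : realType) (A : finType) (x : iword A) : Prop :=
  forall (l : nat) (u : seq A), (1 <= l)%N -> size u = l ->
    (fun n : nat => (al_count x u n)%:R / (n%:R / l%:R) : R) @ \oo
      --> ((#|A|%:R)^-1 ^+ l : R).

(** ** k-automata: finite state set 'I_nst, transitions labelled by
    k-tuples over A ∪ {ε} (ε = None), set of initial states. *)
Record automaton (A : finType) (k : nat) := Automaton {
  nst : nat;
  delta : {set 'I_nst * k.-tuple (option A) * 'I_nst};
  init : {set 'I_nst} }.

Section Automata.
Variables (A : finType) (k : nat) (M : automaton A k).

Definition transition := ('I_(nst M) * k.-tuple (option A) * 'I_(nst M))%type.
Definition tsrc (t : transition) := t.1.1.
Definition tlab (t : transition) := t.1.2.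
Definition ttgt (t : transition) := t.2.

Definition run := nat -> transition.

Definition comp (r : run) (j : 'I_k) : nat -> option A :=
  fun i => tnth (tlab (r i)) j.

Definition cnt (c : nat -> option A) (i : nat) : nat :=
  \sum_(m < i) (c m != None).

Definition comp_infinite (c : nat -> option A) : Prop :=
  forall m, exists i, (m <= cnt c i)%N.

(** the concatenation of the component c is the infinite word x *)
Definition comp_is (c : nat -> option A) (x : iword A) : Prop :=
  comp_infinite c /\ forall i a, c i = Some a -> x (cnt c i) = a.

Definition accepting (r : run) : Prop :=
  tsrc (r 0%N) \in init M /\
  (forall i, r i \in delta M) /\
  (forall i, ttgt (r i) = tsrc (r i.+1)) /\
  (forall j, comp_infinite (comp r j)).

Definition deterministic (l : nat) : Prop :=
  #|init M| = 1%N /\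
  forall t t', t \in delta M -> t' \in delta M -> tsrc t = tsrc t' ->
    (forall j : 'I_k, (j < l)%N -> tnth (tlab t) j = None ->
        tnth (tlab t') j = None) /\
    ((forall j : 'I_k, (j < l)%N -> tnth (tlab t) j = tnth (tlab t') j) ->
       (forall j : 'I_k, (l <= j)%N -> tnth (tlab t) j = tnth (tlab t') j) /\
       ttgt t = ttgt t').

End Automata.

(** ** Transducers: 1-deterministic 2-automata; tape 0 input, tape 1 output *)
Definition tape0 {k} : 'I_k.+1 := ord0.
Definition tape1 {k} : 'I_k.+2 := lift ord0 ord0.
Definition tape2 : 'I_3 := lift ord0 (lift ord0 ord0).

Definition trans_rel (A : finType) (T : automaton A 2) (x z : iword A) : Prop :=
  exists r : run T, accepting r /\ comp_is (comp r tape0) x /\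
                    comp_is (comp r tape1) z.

Definition one_to_one_transducer (A : finType) (T : automaton A 2) : Prop :=
  deterministic T 1 /\
  forall x x' z, trans_rel T x z -> trans_rel T x' z -> x = x'.

Definition run_ratio (R : realType) (A : finType) (k : nat) (M : automaton A k)
   (r : run M) (jin jout : 'I_k) : nat -> \bar R :=
  fun n => ((cnt (comp r jout) n)%:R / (cnt (comp r jin) n)%:R)%:E.

(** rho_T(x) (defined when T has an accepting run on x) *)
Definition rho_T (R : realType) (A : finType) (T : automaton A 2) (r : run T)
  : \bar R := limn_einf (run_ratio R r tape0 tape1).

Definition rho (R : realType) (A : finType) (x : iword A) : \bar R :=
  ereal_inf [set v : \bar R | exists (T : automaton A 2) (r : run T),
     one_to_one_transducer T /\ accepting r /\ comp_is (comp r tape0) x /\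
     v = rho_T R r].

(** ** Compressors: 2-deterministic 3-automata; tapes: input x, oracle y,
    output *)
Definition comp_rel (A : finType) (C : automaton A 3) (x y z : iword A) : Prop :=
  exists r : run C, accepting r /\ comp_is (comp r tape0) x /\
     comp_is (comp r tape1) y /\ comp_is (comp r tape2) z.

Definition compressor (A : finType) (C : automaton A 3) : Prop :=
  deterministic C 2 /\
  forall y x x' z, comp_rel C x y z -> comp_rel C x' y z -> x = x'.

Definition rho_C (R : realType) (A : finType) (C : automaton A 3) (r : run C)
  : \bar R := limn_einf (run_ratio R r tape0 tape2).

Definition rho_cond (R : realType) (A : finType) (x y : iword A) : \bar R :=
  ereal_inf [set v : \bar R | exists (C : automaton A 3) (r : run C),
     compressor C /\ accepting r /\ comp_is (comp r tape0) x /\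
     comp_is (comp r tape1) y /\ v = rho_C R r].

Definition fs_independent (R : realType) (A : finType) (x y : iword A) : Prop :=
  rho_cond R x y = rho R x /\ rho_cond R y x = rho R y /\
  rho R x <> 0%E /\ rho R y <> 0%E.

(* Main.v *)
Require Import Defs.
From mathcomp Require Import all_boot all_order all_algebra.
From mathcomp Require Import all_classical all_reals.
From mathcomp Require Import ereal topology normedtype sequences.
From mathcomp Require Import zify ring lra.

(** A normal word is incompressible: cut a run of an injective transducer at the
    ends of the input blocks of length l.  By injectivity a block is determined by
    the two end states and the output of its segment, so only few blocks have a
    short output, and by normality these few blocks are rare.  Hence rho x >= 1,
    and by independence rho (x / y) >= 1.

    If the pair of blocks (u0, v0) does not have the right limiting frequency in
    (x, y), then, as y is normal, the number of positions where (u0, v0) occurs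
    infinitely often differs by a linear amount from #|A| ^ -l times the number of
    positions where v0 occurs in y.  By Chebyshev, given m consecutive blocks of y,
    very few of the m-tuples of blocks deviate in this way.  A compressor writes
    such an atypical m-tuple as its index in the list of atypical ones, and the
    others literally, with one flag letter in front.  Since a positive proportion
    of the m-tuples is atypical along a subsequence, rho (x / y) < 1, a
    contradiction. *)

Set Implicit Arguments. Unset Strict Implicit. Unset Printing Implicit Defensive.
Import Order.TTheory GRing.Theory Num.Theory numFieldNormedType.Exports.
Local Open Scope ring_scope.
Local Notation factor := Defs.factor.
Local Notation comp := Defs.comp.

(** * Sublinear deviations and block frequencies *)

Section Sublinear.
Variable R : realType.
Implicit Types f g : nat -> R.

(** This is [f N = o(N)]. Convergence of a frequency is restated as a sublinear deviation of a
    count, so that deviations can be added without quotients. *)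
Definition sublinear f := forall e : R, 0 < e ->
  exists N0, forall N, (N0 <= N)%N -> `|f N| <= e * N%:R.

Lemma eq_sublinear f g : f =1 g -> sublinear f -> sublinear g.
Proof.
by move=> fg sf e /sf[N0 h]; exists N0 => N /h; rewrite fg.
Qed.

Lemma sublinear0 : sublinear (fun=> 0).
Proof. by move=> e e0; exists 0%N => N _; rewrite normr0 mulr_ge0// ltW. Qed.

Lemma sublinearD f g : sublinear f -> sublinear g ->
  sublinear (fun N => f N + g N).
Proof.
move=> sf sg e e0; have e20 : 0 < e / 2 by rewrite divr_gt0.
have [N1 h1] := sf _ e20; have [N2 h2] := sg _ e20.
exists (maxn N1 N2) => N; rewrite geq_max => /andP[/h1 {}h1 /h2 {}h2].
by rewrite (le_trans (ler_normD _ _))// [e in e * _](splitr e) mulrDl lerD.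
Qed.

Lemma sublinearZ (a : R) f : sublinear f -> sublinear (fun N => a * f N).
Proof.
move=> sf e e0; have a0 : 0 < `|a| + 1 by rewrite ltr_wpDl.
have [N0 h] := sf (e / (`|a| + 1)) (divr_gt0 e0 a0); exists N0 => N /h {}h.
rewrite normrM (@le_trans _ _ ((`|a| + 1) * `|f N|)) ?ler_wpM2r ?lerDl//.
by rewrite -ler_pdivlMl// mulrA [_^-1 * e]mulrC.
Qed.

Lemma sublinear_sum (I : finType) (F : I -> nat -> R) :
  (forall i, sublinear (F i)) -> sublinear (fun N => \sum_i F i N).
Proof.
move=> sF; elim: (index_enum I) => [|i s IHs].
  by apply: eq_sublinear sublinear0 => N; rewrite big_nil.
by apply: eq_sublinear (sublinearD (sF i) IHs) => N; rewrite big_cons.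
Qed.

Lemma bounded_sublinear f (c : R) : (forall N, `|f N| <= c) -> sublinear f.
Proof.
move=> fc e e0; have c0 : 0 <= c by rewrite (le_trans _ (fc 0%N)).
exists (Num.truncn (c / e)).+1 => N hN; apply: le_trans (fc N) _.
rewrite -ler_pdivrMl// mulrC ltW//; apply: lt_le_trans (truncnS_gt _) _.
by rewrite ler_nat.
Qed.

(** Meant for rounding: [h] will be the quotient by a block length or by 2. *)
Lemma sublinear_comp f (h : nat -> nat) : {homo h : m n / (m <= n)%N} ->
  (forall m, exists n, (m <= h n)%N) -> (forall n, (h n <= n)%N) ->
  sublinear f -> sublinear (f \o h).
Proof.
move=> hh hinf hle sf e e0; have [N0 hN] := sf e e0; have [n hn] := hinf N0.
exists n => N nN /=; have /hN : (N0 <= h N)%N by exact: leq_trans hn (hh _ _ nN).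
by move=> /le_trans; apply; rewrite ler_pM2l ?ler_nat.
Qed.

End Sublinear.

(** * Aligned occurrences counted over consecutive blocks *)

Section BlockCount.
Variable A : finType.
Implicit Types (z : iword A) (u : seq A).

Definition block_count z u N : nat :=
  \sum_(i < N) (factor z (i * size u) (size u) == u).

Lemma al_countE z u n : (0 < size u)%N ->
  al_count z u n = block_count z u (n %/ size u).
Proof.
set l := size u => l0.
rewrite /al_count /block_count -/l.
rewrite -sum1_card [RHS](eq_bigr (fun i : 'I_(n %/ l) =>
  if factor z (i * l) l == u then 1%N else 0%N)); last by move=> i _; case: ifP.
rewrite -big_mkcond /=.
have f_lt (i : 'I_(n %/ l)) : (i * l < n)%N.
  by have := ltn_ord i; rewrite leq_divRL// mulSn; lia.
pose f i := Ordinal (f_lt i).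
have f_inj : injective f.
  by move=> i j /(congr1 val)/= /eqP; rewrite eqn_pmul2r// => /eqP/val_inj.
rewrite sum1_card sum1_card -(card_imset _ f_inj); apply: eq_card => i.
apply/idP/imsetP => [|[j]].
  rewrite in_setE /= -/l => /and3P[/eqP il iln iu].
  have hi : (i %/ l < n %/ l)%N.
    by rewrite leq_divRL// mulSn {1}(divn_eq i l) il addn0 addnC in iln *.
  have ie : i = (i %/ l * l)%N :> nat by rewrite {1}(divn_eq i l) il addn0.
  exists (Ordinal hi); last by apply: val_inj.
  by rewrite unfold_in /= -ie.
rewrite unfold_in => ju ->; rewrite in_setE /= -/l modnMl eqxx /=.
by have := ltn_ord j; rewrite leq_divRL// mulSn addnC => ->; exact: ju.
Qed.

(** At multiples of [size u] both sides involve the same quotient. Any other prefix ends in an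
    incomplete block, which changes the deviation by a bounded amount only. *)
Lemma normal_block_count (R : realType) z : normal R z <-> forall u, (0 < size u)%N ->
  sublinear (fun N => (block_count z u N)%:R - (#|A|%:R^-1 ^+ size u) * N%:R : R).
Proof.
split=> [nz u u0 e e0|nz l u l0 ul].
  have /cvgrPdist_le /(_ e e0)[N0 _ hN] := nz _ u u0 erefl.
  exists N0.+1 => N hN0; have N0' : (0 < N)%N by lia.
  have := hN (N * size u)%N; rewrite /= al_countE// mulnK// => h.
  have {}h := h (leq_trans (ltnW hN0) (leq_pmulr _ u0)).
  rewrite natrM mulfK ?pnatr_eq0 -?lt0n// in h.
  rewrite distrC -ler_pdivrMr ?ltr0n// -[N%:R^-1]ger0_norm ?invr_ge0//.
  by rewrite -normrM mulrBl mulfK// pnatr_eq0 -lt0n.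
set c := (_ ^+ l : R).
have {}nz := nz u; rewrite ul in nz; have {}nz := nz l0.
apply/cvgrPdist_le => e e0.
have l0r : 0 < l%:R :> R by rewrite ltr0n.
pose g n : R := (block_count z u (n %/ l))%:R - c * (n%:R / l%:R).
have sg : sublinear g.
  apply: (@eq_sublinear _ (fun n => (((block_count z u (n %/ l))%:R - c * (n %/ l)%:R)
      + - c * ((n %% l)%:R / l%:R)))).
    move=> n; rewrite /g; rewrite [n in c * (n%:R / _)](divn_eq n l).
    rewrite natrD natrM mulrDl mulfK ?lt0r_neq0//; ring.
  apply: sublinearD; last first.
    apply: sublinearZ; apply: (@bounded_sublinear _ _ 1) => n.
    by rewrite ger0_norm ?divr_ge0// ler_pdivrMr// mul1r ler_nat ltnW// ltn_pmod.
  apply: (sublinear_comp (h := fun n => (n %/ l)%N) _ _ _ nz).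
  - by move=> m n; exact: leq_div2r.
  - by move=> m; exists (m * l)%N; rewrite mulnK.
  - by move=> n; exact: leq_div.
have [N0 hN] := sg (e / l%:R) (divr_gt0 e0 l0r).
exists N0.+1 => // n /= nN; have n0 : 0 < n%:R :> R by rewrite ltr0n; lia.
have {hN} := hN n (ltnW nN); rewrite /g al_countE ul//.
set B := (block_count _ _ _)%:R => h.
rewrite -mulrA mulrC [l%:R^-1 * _]mulrC in h.
have nl0 : 0 < n%:R / l%:R :> R by rewrite divr_gt0.
rewrite -(ler_pM2r nl0) -[X in _ * X <= _](ger0_norm (ltW nl0)) -normrM.
by rewrite mulrBl divfK ?lt0r_neq0// distrC [c * _]mulrC.
Qed.

End BlockCount.

(** * Normal words are incompressible *)

Section Liminf.
Variable R : realType.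
Implicit Types (u : nat -> \bar R) (c : \bar R).

Lemma limn_einf_ge u c n0 : (forall n, (n0 <= n)%N -> (c <= u n)%E) ->
  (c <= limn_einf u)%E.
Proof.
move=> uc; rewrite limn_einf_lim; apply: lime_ge; first exact: is_cvg_einfs.
exists n0 => // n /= n0n; apply: le_ereal_inf_tmp => _ [m /= nm <-].
by apply: uc; exact: leq_trans nm.
Qed.

(** Infinitely many indices suffice, so it is enough to compress along a subsequence. *)
Lemma limn_einf_le u c : (forall n0, exists2 n, (n0 <= n)%N & (u n <= c)%E) ->
  (limn_einf u <= c)%E.
Proof.
move=> uc; rewrite limn_einf_lim; apply: lime_le; first exact: is_cvg_einfs.
exists 0%N => // n0 _; have [n n0n] := uc n0; apply: le_trans.
by apply: ereal_inf_lbound; exists n.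
Qed.

End Liminf.

(** * Letters carried by one component of a run *)

Section Counting.
Variable A : finType.
Implicit Type c : nat -> option A.

Lemma cnt0 c : cnt c 0 = 0%N.
Proof. by rewrite /cnt big_ord0. Qed.

Lemma cntS c i : cnt c i.+1 = (cnt c i + (c i != None))%N.
Proof. by rewrite /cnt big_ord_recr. Qed.

Lemma cntD c i j : cnt c (i + j) = (cnt c i + cnt (fun k => c (i + k)%N) j)%N.
Proof.
by elim: j => [|j IHj]; rewrite ?(cnt0, addn0)// addnS !cntS IHj addnA.
Qed.

Lemma eq_cnt c c' i : (forall m, (m < i)%N -> c m = c' m) -> cnt c i = cnt c' i.
Proof.
elim: i => [|i IHi] cc'; first by rewrite !cnt0.
by rewrite !cntS cc'// IHi// => m /ltnW; exact: cc'.
Qed.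

Lemma leq_cnt c i j : (i <= j)%N -> (cnt c i <= cnt c j)%N.
Proof. by move=> /subnKC <-; rewrite cntD leq_addr. Qed.

Lemma ltn_cnt c i j : (cnt c i < cnt c j)%N -> (i < j)%N.
Proof. by apply: contraTltn; rewrite -leqNgt => /leq_cnt. Qed.

Lemma cnt_ltn c i j a : (i < j)%N -> c i = Some a -> (cnt c i < cnt c j)%N.
Proof. by move=> ij ci; rewrite (leq_trans _ (leq_cnt c ij))// cntS ci addn1. Qed.

(** The count grows by at most one per step, so it cannot jump over [k]. *)
Lemma first_hit c k : comp_infinite c ->
  exists i, cnt c i = k /\ forall j, (k <= cnt c j)%N -> (i <= j)%N.
Proof.
move=> /(_ k) ex; case: (ex_minnP ex) => i ki imin; exists i; split=> //.
apply/eqP; rewrite eqn_leq ki andbT; case: i imin {ki} => [|i] imin.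
  by rewrite cnt0.
have : (cnt c i < k)%N by rewrite ltnNge; apply/negP => /imin; rewrite ltnn.
by rewrite cntS; case: (_ != _) => /=; lia.
Qed.

Lemma comp_is_ex c : comp_infinite c -> exists z, comp_is c z.
Proof.
move=> cinf; suff [z zP] : exists z : nat -> A, forall k,
    exists2 i, cnt c i = k & c i = Some (z k).
  exists z; split=> // i a ci; have [j ji cj] := zP (cnt c i).
  suff ij : i = j by move: cj; rewrite -ij ci => -[].
  case: (ltngtP i j) => // [/(cnt_ltn)/(_ ci)|/(cnt_ltn)/(_ cj)].
    by rewrite ji ltnn.
  by rewrite ji ltnn.
suff /choice[z zP] : forall k, exists a, exists2 i, cnt c i = k & c i = Some a.
  by exists z.
move=> k.
(* By minimality, the step just before the count first reaches [k.+1] carries a letter: letter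
   number [k]. *)
have [i [ci imin]] := first_hit k.+1 cinf.
case: i ci imin => [|i]; first by rewrite cnt0.
rewrite cntS => ci imin; case E : (c i) => [a|].
  by exists a, i => //; move: ci; rewrite E /=; lia.
by have := imin i; rewrite ltnn E /= addn0 in ci *; rewrite ci leqnn => /(_ isT).
Qed.

Lemma comp_is_uniq c (x x' : iword A) : comp_is c x -> comp_is c x' -> x = x'.
Proof.
move=> [cinf cx] [_ cx']; apply: funext => k.
have [i [ci imin]] := first_hit k.+1 cinf.
case: i ci imin => [|i]; first by rewrite cnt0.
rewrite cntS => ci imin; case E1 : (c i) ci => [a|] /= ci.
  have <- : cnt c i = k by lia.
  by rewrite (cx _ _ E1) (cx' _ _ E1).
by have := imin i; rewrite -ci addn0 leqnn => /(_ isT); rewrite ltnn.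
Qed.

End Counting.

(** A change of time: the [d] steps from [s] on are replaced by a copy of the [d'] steps from [s']
    on, and then the old run resumes at [s + d]. *)
Definition splice s d s' d' k : nat :=
  if (k < s)%N then k else if (k < s + d')%N then (k - s + s')%N
  else (k - (s + d') + (s + d))%N.

Section Splice.
Local Open Scope nat_scope.
Variable A : finType.
Variables (s d s' d' : nat).
Let sigma := splice s d s' d'.

Lemma splice_pre k : (k < s)%N -> sigma k = k.
Proof. by rewrite /sigma /splice => ->. Qed.

Lemma splice_mid j : (j < d')%N -> sigma (s + j) = (s' + j)%N.
Proof.
by move=> jd; rewrite /sigma /splice ifF ?ifT; lia.
Qed.

Lemma splice_post j : sigma (s + d' + j) = (s + d + j)%N.
Proof. by rewrite /sigma /splice !ifF; lia. Qed.

Lemma splice_ind (P : nat -> Prop) : (forall k, (k < s)%N -> P k) ->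
  (forall j, (j < d')%N -> P (s + j)%N) -> (forall j, P (s + d' + j)%N) ->
  forall k, P k.
Proof.
move=> P1 P2 P3 k; have [/P1//|sk] := ltnP k s.
have [kd|dk] := ltnP k (s + d').
  by rewrite -(subnKC sk); apply: P2; lia.
by rewrite -(subnKC dk).
Qed.

Variables (c : nat -> option A) (L : nat).
Hypothesis cd : cnt c (s + d) = (cnt c s + L)%N.
Hypothesis cd' : cnt c (s' + d') = (cnt c s' + L)%N.
Let c' := c \o sigma.

Lemma cnt_splice_pre k : (k <= s)%N -> cnt c' k = cnt c k.
Proof.
by move=> ks; apply: eq_cnt => m mk; rewrite /c' /= splice_pre//; lia.
Qed.

Lemma cnt_splice_mid j : (j <= d')%N ->
  cnt c' (s + j) = (cnt c s + (cnt c (s' + j) - cnt c s'))%N.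
Proof.
elim: j => [|j IHj] jd; first by rewrite !addn0 subnn addn0 cnt_splice_pre.
rewrite !addnS !cntS IHj; last by lia.
rewrite /c' /= splice_mid//.
have : (cnt c s' <= cnt c (s' + j))%N by apply: leq_cnt; lia.
by lia.
Qed.

Lemma cnt_splice_post j : cnt c' (s + d' + j) = cnt c (s + d + j).
Proof.
elim: j => [|j IHj]; first by rewrite !addn0 cnt_splice_mid// cd' cd; lia.
by rewrite !addnS !cntS IHj /c' /= splice_post.
Qed.

(** The two segments may differ in duration, but both carry [L] letters, so the letters after the
    replaced window keep their positions. *)
Lemma comp_is_splice w : comp_is c w -> comp_is c' (fun n =>
  if (cnt c s <= n < cnt c s + L)%N then w (n - cnt c s + cnt c s')%N else w n).
Proof.
move=> [cinf cw]; split=> [m|].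
  have [i mi] := cinf m; exists (s + d' + i)%N; rewrite cnt_splice_post.
  by rewrite (leq_trans mi)// leq_cnt// leq_addl.
apply: splice_ind => [k ks|j jd|j] a.
- rewrite (cnt_splice_pre (ltnW ks)) /c' /= (splice_pre ks) => ck.
  by rewrite leqNgt (cnt_ltn ks ck)/= (cw _ _ ck).
- rewrite (cnt_splice_mid (ltnW jd)) /c' /= (splice_mid jd) => cj.
  have h1 : (cnt c s' <= cnt c (s' + j))%N by apply: leq_cnt; lia.
  have : (s' + j < s' + d')%N by lia.
  move=> /cnt_ltn/(_ cj); rewrite cd' => h2.
  by rewrite ifT ?addKn ?subnK ?(cw _ _ cj)//; lia.
- rewrite cnt_splice_post /c' /= splice_post => cj.
  have h1 : (cnt c (s + d) <= cnt c (s + d + j))%N by apply: leq_cnt; lia.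
  by rewrite ifF ?(cw _ _ cj)//; lia.
Qed.

End Splice.

(* The runs on [x] and on the word obtained from [x] by copying one segment of
   the run over another one have the same output. *)
Lemma one_to_one_segment (A : finType) (T : automaton A 2) (r : run T)
    (x z : iword A) (s d s' d' L M : nat) :
  one_to_one_transducer T -> accepting r ->
  comp_is (comp r tape0) x -> comp_is (comp r tape1) z ->
  (0 < d')%N ->
  tsrc (r s) = tsrc (r s') -> tsrc (r (s + d)%N) = tsrc (r (s' + d')%N) ->
  cnt (comp r tape0) (s + d) = (cnt (comp r tape0) s + L)%N ->
  cnt (comp r tape0) (s' + d') = (cnt (comp r tape0) s' + L)%N ->
  cnt (comp r tape1) (s + d) = (cnt (comp r tape1) s + M)%N ->
  cnt (comp r tape1) (s' + d') = (cnt (comp r tape1) s' + M)%N ->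
  (forall n, (n < M)%N ->
    z (cnt (comp r tape1) s + n)%N = z (cnt (comp r tape1) s' + n)%N) ->
  forall n, (n < L)%N ->
    x (cnt (comp r tape0) s + n)%N = x (cnt (comp r tape0) s' + n)%N.
Proof.
move=> [_ inj] [r0 [rd [rt rinf]]] rx rz d0 ss sd c0 c0' c1 c1' zz n nL.
pose r' : run T := r \o splice s d s' d'.
have rx' := comp_is_splice c0 c0' rx; have rz' := comp_is_splice c1 c1' rz.
set x' := fun _ => _ in rx'; set z' := fun _ => _ in rz'.
have z'z : z' = z.
  apply: funext => k; rewrite /z'; case: ifP => // /andP[k1 k2].
  rewrite -[in RHS](subnKC k1) zz; last by lia.
  by rewrite addnC.
(* The spliced run is connected: at its two seams the states agree by [ss] and [sd]. *)
have st k : tsrc (r (splice s d s' d' k.+1)) = tsrc (r (splice s d s' d' k).+1).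
  elim/(@splice_ind s d'): k => [k ks|j jd|j].
  - rewrite (splice_pre _ _ _ ks); have [ks'|sk] := ltnP k.+1 s.
      by rewrite splice_pre.
    have -> : k.+1 = (s + 0)%N by lia.
    by rewrite splice_mid// !addn0 ss.
  - rewrite splice_mid// -addnS; have [jd'|dj] := ltnP j.+1 d'.
      by rewrite splice_mid// addnS.
    have -> : (s + j.+1 = s + d' + 0)%N by lia.
    rewrite splice_post addn0 sd; congr (tsrc (r _)); lia.
  - by rewrite -addnS !splice_post addnS.
have acc' : accepting r'.
  split; last split; last split.
  - suff -> : tsrc (r' 0%N) = tsrc (r 0%N) by [].
    (* If [s = 0], the spliced run starts at time [s'] because [0 < d']; the state there is that of
       time 0. *)
    rewrite /r' /=; case: (posnP s) => [s0|s0]; last by rewrite splice_pre.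
    have -> : splice s d s' d' 0 = s'.
      by rewrite [in X in splice X]s0 -[LHS]/(splice 0 d s' d' 0) /splice d0.
    by rewrite -ss s0.
  - by move=> i; exact: rd.
  - by move=> i; rewrite /r' /= st rt.
  - move=> j; case: (unliftP ord0 j) => [i ->|->]; last exact: rx'.1.
    by rewrite (ord1 i); exact: rz'.1.
(* Both input words produce the output [z], so injectivity applies. *)
have xx' : x' = x.
  apply: (inj _ _ z); last by exists r.
  by exists r'; split=> //; split=> //; rewrite -z'z.
rewrite -{1}xx' /x' ifT; last by lia.
by rewrite addKn addnC.
Qed.

Lemma exp2_dominates (X : nat) : exists2 k, (0 < k)%N & (X * k <= 2 ^ k)%N.
Proof.
(* With [Y = 2X + 1] and [k = 2Y], the power [2 ^ k] is the square of [2 ^ Y], hence at least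
   [Y * Y], which exceeds [X * k]. *)
exists (X.*2.+1 + X.*2.+1)%N => //; rewrite expnD.
have := ltn_expl X.*2.+1 (ltnSn 1); set y := (2 ^ _)%N => h.
apply: (@leq_trans (X.*2.+1 * X.*2.+1)); first by nia.
by rewrite leq_mul// ltnW.
Qed.

(** * Lower bound for the output of an injective transducer on a normal word *)

Section Incompressible.
Variables (R : realType) (A : finType).
Hypothesis A2 : (1 < #|A|)%N.
Variables (x : iword A) (T : automaton A 2) (r : run T).
Hypotheses (nx : normal R x) (Tinj : one_to_one_transducer T).
Hypotheses (racc : accepting r) (rx : comp_is (comp r tape0) x).
Local Notation c0 := (comp r tape0).
Local Notation c1 := (comp r tape1).

(* Distinct blocks of [x] that are mapped to short outputs are told apart by
   the two end states of the segment and by the output. *)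
Lemma few_short_outputs (l t : nat) (tau : nat -> nat) :
  (0 < l)%N -> (forall j, cnt c0 (tau j) = (j * l)%N) ->
  exists2 S : {set l.-tuple A},
    (#|S| <= nst T * nst T * t.+1 * #|A| ^ t)%N &
    forall j, (cnt c1 (tau j.+1) - cnt c1 (tau j) <= t)%N ->
      exists2 u, u \in S & factor x (j * l) l = u :> seq A.
Proof.
move=> l0 tauE.
have [z rz] : exists z, comp_is c1 z.
  by apply: comp_is_ex; case: racc => _ [_ [_]]; exact.
have tau_lt j : (tau j < tau j.+1)%N by apply: (@ltn_cnt _ c0); rewrite !tauE; nia.
pose o j := (cnt c1 (tau j.+1) - cnt c1 (tau j))%N.
pose P (u : l.-tuple A) j := (o j <= t)%N /\ factor x (j * l) l = u.
pose S := [set u | `[< exists j, P u j >]].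
have /choice[f fP] : forall u : l.-tuple A, exists j, u \in S -> P u j.
  move=> u; have [uS|uS] := boolP (u \in S); last by exists 0%N.
  by move: uS; rewrite inE => /asboolP[j Pj]; exists j.
exists S; last first.
  move=> j ojt; have sz : size (factor x (j * l) l) == l by rewrite size_mkseq.
  by exists (Tuple sz) => //; rewrite inE; apply/asboolP; exists j.
(* On [S] the output length is at most [t], so [inord] loses nothing. Always recording [t] letters
   of [z] gives a tuple of fixed length, of which the segment uses a beginning. *)
pose g u := (tsrc (r (tau (f u))), tsrc (r (tau (f u).+1)),
  inord (o (f u)) : 'I_t.+1, [tuple z (cnt c1 (tau (f u)) + i)%N | i < t]).
have ginj : {in S &, injective g}.
  move=> u v /fP[ou uE] /fP[ov vE] [e1 e2 e3 e4].
  have {}e3 : o (f u) = o (f v).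
    by move/(congr1 val): e3; rewrite /= !inordK.
  have zz n : (n < t)%N ->
      z (cnt c1 (tau (f u)) + n)%N = z (cnt c1 (tau (f v)) + n)%N.
    move=> nt; move/eq_in_map: e4 => /(_ (Ordinal nt))/=; apply.
    by rewrite mem_enum.
  have h1 j : (cnt c1 (tau j) <= cnt c1 (tau j.+1))%N by apply/leq_cnt/ltnW.
  have h2 j := subnKC (ltnW (tau_lt j)).
  apply: val_inj; rewrite /= -uE -vE; apply/eq_in_map => n.
  rewrite mem_iota add0n /= => nl; rewrite -!tauE.
  apply: (@one_to_one_segment A T r x z _ (tau (f u).+1 - tau (f u))%N _
    (tau (f v).+1 - tau (f v))%N l (o (f u))) => //; rewrite ?h2 ?tauE//.
  - by rewrite subn_gt0.
  - by rewrite mulSn addnC.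
  - by rewrite mulSn addnC.
  - by rewrite subnKC.
  - by rewrite e3 subnKC.
  - by move=> k ko; apply: zz; exact: leq_trans ou.
rewrite -(card_in_imset ginj); apply: leq_trans (max_card _) _.
by rewrite !card_prod !card_ord card_tuple.
Qed.

(** An output of a block of length [l = k * h] is short if it has at most [t = l - k] letters. Short
    outputs come from at most a proportion [1/h] of the words, hence by normality from at most [2/h]
    of the blocks of [x]; each other block yields at least [t = (1 - 1/h) l] letters. *)
Lemma output_lower_bound (h : nat) : (0 < h)%N ->
  exists l, exists2 N0, (0 < l)%N & forall n N, (N0 <= N)%N ->
    (N * l <= cnt c0 n)%N ->
    (1 - h%:R^-1) * (1 - 2 / h%:R) * (N * l)%:R <= (cnt c1 n)%:R :> R.
Proof.
(* Since [t + 1 <= k * h], this [k] makes [#|A| ^ k] at least [h] times the factor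
   [nst T * nst T * t.+1] in the bound on [S]. *)
move=> h0; have [k k0 kX] := exp2_dominates (nst T * nst T * h * h).
pose l := (k * h)%N; pose t := (k * h.-1)%N.
have l0 : (0 < l)%N by rewrite muln_gt0 k0.
have /choice[tau tauP] : forall j, exists i, cnt c0 i = (j * l)%N /\
    forall i', (j * l <= cnt c0 i')%N -> (i <= i')%N.
  by move=> j; apply: first_hit; case: rx.
have tauE j := (tauP j).1.
have [S cardS SP] := few_short_outputs t l0 tauE.
have Sh : (#|S| * h <= #|A| ^ l)%N.
  have lE : l = (t + k)%N by rewrite /l /t -[in LHS](prednK h0) mulnS addnC.
  have kA : (nst T * nst T * h * h * k <= #|A| ^ k)%N.
    by apply: leq_trans kX _; rewrite leq_exp2r.
  have th : (t.+1 <= k * h)%N by rewrite /t -[X in (_ < k * X)%N](prednK h0); nia.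
  rewrite [X in (_ ^ X)%N]lE expnD; apply: leq_trans (leq_mul cardS (leqnn h)) _.
  rewrite (_ : (_ * h)%N = #|A| ^ t * (nst T * nst T * t.+1 * h))%N; last by ring.
  rewrite leq_mul2l; apply/orP; right; apply: leq_trans kA.
  rewrite (_ : (_ * k)%N = nst T * nst T * (k * h) * h)%N; last by ring.
  by rewrite leq_mul2r leq_mul2l th !orbT.
have hr0 : 0 < h%:R :> R by rewrite ltr0n.
pose b := (#|A|%:R^-1 ^+ l : R).
have : sublinear (fun N => \sum_(u in S) ((block_count x u N)%:R - b * N%:R)).
  apply: (@eq_sublinear _ (fun N => \sum_(u : l.-tuple A)
      if u \in S then (block_count x u N)%:R - b * N%:R else 0)) => [N|].
    by rewrite [RHS]big_mkcond.
  apply: sublinear_sum => u; case: (u \in S); last exact: sublinear0.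
  by have := (normal_block_count R x).1 nx u; rewrite size_tuple; exact.
move=> /(_ h%:R^-1); rewrite invr_gt0 => /(_ hr0)[N0 hN0].
exists l, N0 => // n N NN0 Nn.
pose o j := (cnt c1 (tau j.+1) - cnt c1 (tau j))%N.
have tau_lt j : (tau j < tau j.+1)%N by apply: (@ltn_cnt _ c0); rewrite !tauE; nia.
have cntE M : cnt c1 (tau M) = (cnt c1 (tau 0) + \sum_(j < M) o j)%N.
  elim: M => [|M IHM]; first by rewrite big_ord0 addn0.
  by rewrite big_ord_recr /= addnA -IHM subnKC// leq_cnt// ltnW.
have low : (\sum_(j < N) (o j <= t)%N <= \sum_(u in S) block_count x u N)%N.
  rewrite /block_count exchange_big /=; apply: leq_sum => j _.
  have [/SP[u uS uE]|//] := leqP (o j) t.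
  by rewrite (bigD1 u)//= size_tuple uE eqxx leq_addr.
have lowR : (\sum_(j < N) (o j <= t)%N)%:R <= 2 / h%:R * N%:R :> R.
  have {}low : (\sum_(j < N) (o j <= t)%N)%:R
      <= (\sum_(u in S) block_count x u N)%:R :> R by rewrite ler_nat.
  apply: le_trans low _; rewrite natr_sum.
  have := hN0 N NN0; rewrite sumrB sumr_const => /ler_normlP[_].
  rewrite lerBlDr => /le_trans; apply.
  (* One [1/h] absorbs the sublinear error, the other bounds the proportion of words in [S]. *)
  have -> : 2 / h%:R * N%:R = h%:R^-1 * N%:R + h%:R^-1 * N%:R :> R by ring.
  rewrite lerD2l -[leLHS]mulr_natl mulrA.
  rewrite ler_wpM2r// -[leRHS]mul1r ler_pdivlMr// /b exprVn mulrAC ler_pdivrMr.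
    by rewrite mul1r -natrX -natrM ler_nat.
  by rewrite exprn_gt0// ltr0n (ltn_trans _ A2).
have high : (t * (N - \sum_(j < N) (o j <= t)%N) <= cnt c1 n)%N.
  have tn : (tau N <= n)%N by exact: (tauP N).2.
  apply: leq_trans (leq_cnt _ tn); rewrite cntE.
  apply: leq_trans (leq_addl _ _).
  have -> : (N - \sum_(j < N) (o j <= t)%N = \sum_(j < N) (1 - (o j <= t)%N))%N.
    by rewrite sumnB => [|i _]; rewrite ?leq_b1// sum_nat_const card_ord muln1.
  rewrite big_distrr /=; apply: leq_sum => j _.
  by have [_|/ltnW] := leqP (o j) t; rewrite ?muln0 ?muln1.
have lowN : (\sum_(j < N) (o j <= t)%N <= N)%N.
  rewrite -[X in (_ <= X)%N](card_ord N) -sum1_card; apply: leq_sum => j _.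
  exact: leq_b1.
have {}high : t%:R * (N%:R - (\sum_(j < N) (o j <= t)%N)%:R) <= (cnt c1 n)%:R :> R.
  by rewrite -natrB// -natrM ler_nat.
apply: le_trans high.
have -> : t%:R = (1 - h%:R^-1) * l%:R :> R.
  rewrite /t /l !natrM -subn1 natrB//; field; exact: lt0r_neq0.
rewrite natrM -!mulrA ler_wpM2l//.
  by rewrite subr_ge0 invf_le1// ler1n.
rewrite [leLHS]mulrC -mulrA mulrCA ler_wpM2l//.
by rewrite mulrBr mulr1 lerD2l lerN2 mulrC.
Qed.

Lemma rho_T_ge (th : R) : th < 1 -> (th%:E <= rho_T R r)%E.
Proof.
(* Now [4/h < 1 - th]: the product in [output_lower_bound] loses at most [3/h], and the incomplete
   last input block costs at most [1/h] once more than [h] blocks have been read. *)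
move=> th1; pose h := (Num.truncn (4 / (1 - th))).+1.
have th0 : 0 < 1 - th by rewrite subr_gt0.
have hth : 4 / (1 - th) < h%:R by exact: truncnS_gt.
have [l [N0 l0 lP]] := output_lower_bound (ltn0Sn _ : (0 < h)%N).
have hr0 : 0 < h%:R :> R by rewrite ltr0n.
have [n0 [n0E _]] := first_hit ((N0 + h).+2 * l) (rx.1).
apply: (@limn_einf_ge _ _ _ n0) => n n0n; rewrite lee_fin.
have : ((N0 + h).+2 * l <= cnt c0 n)%N by rewrite -n0E leq_cnt.
have := lP n (cnt c0 n %/ l)%N.
have := ltn_ceil (cnt c0 n) l0; have := leq_divM (cnt c0 n) l.
set N := (cnt c0 n %/ l)%N => h1 h2 h3 h4.
have NN : (N0 + h < N)%N by nia.
have {}h3 := h3 (leq_trans (leq_addr _ _) (ltnW NN)) h1.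
have c00 : 0 < (cnt c0 n)%:R :> R by rewrite ltr0n; nia.
rewrite ler_pdivlMr//.
have [thn|thp] := leP th 0.
  by rewrite (le_trans _ (ler0n _ _))// mulr_le0_ge0// ltW.
apply: le_trans h3.
have h2' : (cnt c0 n)%:R <= N.+1%:R * l%:R :> R by rewrite -natrM ler_nat ltnW.
apply: le_trans (ler_wpM2l (ltW thp) h2') _; rewrite natrM !mulrA ler_wpM2r//.
pose e : R := h%:R^-1.
have he : h%:R * e = 1 by rewrite /e divff// lt0r_neq0.
rewrite -/e.
have e0 : 0 < e by rewrite invr_gt0.
have the : 4 * e < 1 - th.
  rewrite ltr_pdivrMr// mulrC -ltr_pdivrMr// in hth.
have Ne : 1 <= N%:R * e.
  by rewrite -[X in X <= _]he ler_wpM2r ?(ltW e0)// ler_nat; move: NN; rewrite -/h; lia.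
rewrite -[N.+1]addn1 natrD; nra.
Qed.

End Incompressible.

Lemma rho_ge (R : realType) (A : finType) (x : iword A) (th : R) :
  (1 < #|A|)%N -> normal R x -> th < 1 -> (th%:E <= rho R x)%E.
Proof.
move=> A2 nx th1; apply: le_ereal_inf_tmp => _ [T [r [Tinj [racc [rx ->]]]]].
exact: (rho_T_ge A2 nx Tinj racc rx th1).
Qed.

(** * Compression block by block, relative to an oracle *)

Section BlockCompressor.
Local Open Scope nat_scope.
Variables (A : finType) (a0 : A) (K E : nat).
Hypothesis K0 : 0 < K.
Local Notation block := {ffun 'I_K -> A}.

Definition block_of (x : iword A) (q : nat) : block :=
  [ffun j : 'I_K => x (q * K + j)].

(** For each oracle block [v], [code v] is a prefix code for the input blocks. Nonempty code words
    keep the output infinite, and [E] bounds the writing time. *)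
Variable code : block -> block -> seq A.
Hypothesis code0 : forall v u, 0 < size (code v u).
Hypothesis codeE : forall v u, size (code v u) <= E.
Hypothesis code_prefix : forall v u u', prefix (code v u) (code v u') -> u = u'.

Let P := K + E.
Let P0 : 0 < P. Proof. by rewrite ltn_addr. Qed.

(* A block of input and a block of oracle are read in [K] steps, then a code
   word is written in [E] steps, padded with steps that do nothing: the phase of
   the machine is the time modulo [K + E]. *)
Let state := ('I_P * block * block)%type.
Let phase (s : state) := s.1.1.
Let input (s : state) := s.1.2.
Let oracle (s : state) := s.2.

Definition set_letter (u : block) (i : nat) (a : A) : block :=
  [ffun j : 'I_K => if j == i :> nat then a else u j].

Let start : state := (Ordinal P0, [ffun=> a0], [ffun=> a0]).

(** One formula serves both phases: while writing, the phase is at least [K], so [set_letter]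
    changes nothing and [ab] is irrelevant. *)
Definition compress_next (s : state) (ab : A * A) : state :=
  (ordS (phase s), set_letter (input s) (phase s) ab.1,
   set_letter (oracle s) (phase s) ab.2).
Local Notation next := compress_next.

(** Past the end of the code word [onth] returns [None], which provides the padding steps. *)
Definition compress_label (s : state) (ab : A * A) : 3.-tuple (option A) :=
  if phase s < K then [tuple Some ab.1; Some ab.2; None]
  else [tuple None; None; onth (code (oracle s) (input s)) (phase s - K)].
Local Notation label := compress_label.

Let edge (q : state * (A * A)) :=
  (enum_rank q.1, label q.1 q.2, enum_rank (next q.1 q.2)).

Definition block_compressor : automaton A 3 :=
  @Automaton A 3 #|{: state}| [set edge q | q : state * (A * A)]
    [set enum_rank start].
Local Notation C := block_compressor.

Lemma set_letter_out (u : block) i a : K <= i -> set_letter u i a = u.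
Proof.
move=> Ki; apply/ffunP => j; rewrite ffunE ifF//; apply/negbTE.
by rewrite neq_ltn (leq_trans (ltn_ord j) Ki).
Qed.

Lemma block_compressor_deterministic : deterministic C 2.
Proof.
split=> [|t t' /imsetP[[s ab] _ ->] /imsetP[[s' ab'] _ ->]].
  by rewrite /= cards1.
rewrite /tsrc /tlab /ttgt /= => /enum_rank_inj <- {s'}.
rewrite /label; case: ltnP => [sK|Ks].
  split=> [[[|[|[|j]]] ?]//|h].
  have /(_ isT)[e1] := h tape0; have /(_ isT)[e2] := h tape1.
  have -> : ab' = ab by case: ab ab' e1 e2 {h} => [? ?] [? ?] /= -> ->.
  by [].
split=> [[[|[|[|j]]] ?]//|h]; split=> //.
by congr enum_rank; rewrite /next !set_letter_out.
Qed.

Fixpoint states (inp : nat -> A * A) (i : nat) : state :=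
  if i is i'.+1 then next (states inp i') (inp i') else start.

Definition run_of inp : run C := fun i =>
  (enum_rank (states inp i), label (states inp i) (inp i),
   enum_rank (states inp i.+1)).

(** Runs are thus parametrized by streams [inp], whose values at writing steps are arbitrary. *)
Lemma accepting_run_of r : accepting (M := C) r -> exists inp, r = run_of inp.
Proof.
move=> [r0 [rd [rt _]]].
have /choice[f fP] : forall i, exists q, r i = edge q.
  by move=> i; have /imsetP[q _ ->] := rd i; exists q.
exists (snd \o f); apply/funext.
have f0 : (f 0).1 = start.
  by move: r0; rewrite fP inE /tsrc /= => /eqP/enum_rank_inj.
have fS i : (f i.+1).1 = next (f i).1 (f i).2.
  by have := rt i; rewrite !fP /tsrc /ttgt /= => /enum_rank_inj.
have fE i : (f i).1 = states (snd \o f) i.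
  by elim: i => [//|i IHi]; rewrite fS IHi.
by move=> i; rewrite fP /edge /run_of /= -fE.
Qed.

Section Run.
Variable inp : nat -> A * A.

Lemma phase_states i : phase (states inp i) = i %% P :> nat.
Proof.
elim: i => [|i IHi] /=; first by rewrite mod0n.
by rewrite IHi -addn1 modnDml addn1.
Qed.

Lemma phase_block q m : m < P -> phase (states inp (q * P + m)) = m :> nat.
Proof. by move=> mP; rewrite phase_states modnMDl modn_small. Qed.

Lemma buffers_states q m (j : 'I_K) : j < m <= P ->
  input (states inp (q * P + m)) j = (inp (q * P + j)).1 /\
  oracle (states inp (q * P + m)) j = (inp (q * P + j)).2.
Proof.
elim: m => [//|m IHm] /andP[jm mP]; rewrite addnS /= !ffunE phase_block//.
by case: eqP => [<-//|/eqP jm']; apply: IHm; rewrite ltn_neqAle jm' -ltnS jm ltnW.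
Qed.

(** Letter [i] is read in period [i %/ K], at phase [i %% K]. *)
Definition letters1 : iword A := fun i => (inp (i %/ K * P + i %% K)).1.
Definition letters2 : iword A := fun i => (inp (i %/ K * P + i %% K)).2.

Lemma lettersE q j : j < K ->
  letters1 (q * K + j) = (inp (q * P + j)).1 /\
  letters2 (q * K + j) = (inp (q * P + j)).2.
Proof.
move=> jK; rewrite /letters1 /letters2 divnMDl// modnMDl.
by rewrite divn_small// modn_small// addn0.
Qed.

Lemma run_of_label q m : m < P ->
  tlab (run_of inp (q * P + m)) =
    if m < K then [tuple Some (letters1 (q * K + m)); Some (letters2 (q * K + m)); None]
    else [tuple None; None;
      onth (code (block_of letters2 q) (block_of letters1 q)) (m - K)].
Proof.
move=> mP; rewrite /tlab /= /label phase_block//; case: ltnP => [mK|Km].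
  by have [-> ->] := lettersE q mK.
(* From phase [K] on, both buffers have been overwritten completely in the current period. *)
suff [-> ->] : input (states inp (q * P + m)) = block_of letters1 q /\
  oracle (states inp (q * P + m)) = block_of letters2 q by [].
have jm (j : 'I_K) : j < m <= P by rewrite (leq_trans (ltn_ord j) Km) ltnW.
split; apply/ffunP => j; have [e1 e2] := lettersE q (ltn_ord j).
  by rewrite (buffers_states q (jm j)).1 ffunE e1.
by rewrite (buffers_states q (jm j)).2 ffunE e2.
Qed.

Let c0 := comp (run_of inp) tape0.
Let c1 := comp (run_of inp) tape1.
Let c2 := comp (run_of inp) tape2.

Lemma cnt_input_phase (c : nat -> option A) q m :
  (forall j, j < P -> (c (q * P + j) != None) = (j < K)) ->
  m <= P -> cnt c (q * P + m) = cnt c (q * P) + minn m K.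
Proof.
move=> cP; elim: m => [|m IHm] mP; first by rewrite addn0 min0n addn0.
by rewrite addnS cntS IHm ?cP; lia.
Qed.

Lemma cnt_input (c : nat -> option A) q m :
  (forall q j, j < P -> (c (q * P + j) != None) = (j < K)) ->
  m <= P -> cnt c (q * P + m) = q * K + minn m K.
Proof.
move=> cP mP; rewrite (cnt_input_phase (cP q) mP); congr (_ + _); elim: q => [|q IHq].
  by rewrite !mul0n cnt0.
by rewrite !mulSnr (cnt_input_phase (cP q))// IHq (minn_idPr (leq_addr _ _)).
Qed.

Lemma c0E q m : m < P ->
  c0 (q * P + m) = if m < K then Some (letters1 (q * K + m)) else None.
Proof. by move=> mP; rewrite /c0 /comp run_of_label//; case: ifP. Qed.

Lemma c1E q m : m < P ->
  c1 (q * P + m) = if m < K then Some (letters2 (q * K + m)) else None.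
Proof. by move=> mP; rewrite /c1 /comp run_of_label//; case: ifP. Qed.

Lemma c2E q m : m < P -> c2 (q * P + m) = if m < K then None else
  onth (code (block_of letters2 q) (block_of letters1 q)) (m - K).
Proof. by move=> mP; rewrite /c2 /comp run_of_label//; case: ifP. Qed.

Lemma cnt0E q m : m <= P -> cnt c0 (q * P + m) = q * K + minn m K.
Proof. by apply: cnt_input => {}q j /(c0E q) ->; case: ifP. Qed.

Lemma comp_is_input (c : nat -> option A) (w : iword A) :
  (forall q m, m < P -> c (q * P + m) = if m < K then Some (w (q * K + m)) else None) ->
  comp_is c w.
Proof.
move=> cE; have cP q j : j < P -> (c (q * P + j) != None) = (j < K).
  by move=> /(cE q) ->; case: ifP.
split=> [m|i a].
  exists (m * P + 0); rewrite (cnt_input m cP (leq0n _)) min0n addn0; exact: leq_pmulr.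
rewrite (divn_eq i P); set q := i %/ P; have iP := ltn_pmod i P0.
rewrite cE// (cnt_input q cP (ltnW iP)); case: ifP => // iK [<-].
by rewrite (minn_idPl (ltnW iK)).
Qed.

Lemma run_of_input : comp_is c0 letters1.
Proof. exact: comp_is_input c0E. Qed.

Lemma run_of_oracle : comp_is c1 letters2.
Proof. exact: comp_is_input c1E. Qed.

Definition code_size x y q :=
  \sum_(i < q) size (code (block_of y i) (block_of x i)).

Lemma cnt_output_phase q m : m <= P -> cnt c2 (q * P + m) = cnt c2 (q * P) +
  minn (m - K) (size (code (block_of letters2 q) (block_of letters1 q))).
Proof.
elim: m => [|m IHm] mP; first by rewrite addn0 sub0n min0n addn0.
rewrite addnS cntS IHm 1?ltnW// c2E//.
set w := code _ _; have [mK|Km] := ltnP m K.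
  have [-> ->] : m - K = 0 /\ m.+1 - K = 0 by lia.
  by rewrite addn0.
have := onthTE w (m - K); rewrite subSn//.
by case: (onth _ _) => [a|] /= /esym h; lia.
Qed.

Lemma cnt_output q m : m <= P ->
  cnt c2 (q * P + m) = code_size letters1 letters2 q +
    minn (m - K) (size (code (block_of letters2 q) (block_of letters1 q))).
Proof.
move=> mP; rewrite cnt_output_phase//; congr (_ + _); elim: q => [|q IHq].
  by rewrite mul0n cnt0 /code_size big_ord0.
rewrite mulSnr cnt_output_phase// IHq /code_size big_ord_recr /=.
by rewrite /P addKn (minn_idPr (codeE _ _)).
Qed.

Lemma run_of_output z q : comp_is c2 z ->
  factor z (code_size letters1 letters2 q)
    (size (code (block_of letters2 q) (block_of letters1 q))) =
  code (block_of letters2 q) (block_of letters1 q).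
Proof.
move=> [_ c2z]; set w := code _ _.
apply: (@eq_from_nth _ a0); rewrite size_mkseq// => k kw.
have kE : k < E by exact: leq_trans kw (codeE _ _).
have kP : K + k < P by rewrite ltn_add2l.
have := c2z (q * P + (K + k)) (nth a0 w k); rewrite nth_mkseq//.
rewrite cnt_output 1?ltnW// c2E// addKn ltnNge leq_addr /= -/w.
rewrite (minn_idPl (ltnW kw)) => ->//.
by rewrite onthE (nth_map a0).
Qed.

Lemma run_of_output_infinite : comp_infinite c2.
Proof.
move=> m; exists (m * P + 0); rewrite cnt_output// sub0n min0n addn0.
rewrite -[X in X <= _]card_ord -sum1_card; exact: leq_sum.
Qed.

Lemma run_of_accepting : accepting (run_of inp).
Proof.
split; first by rewrite inE.
split; first by move=> i; apply/imsetP; exists (states inp i, inp i).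
split=> // j; case: j => [[|[|[|//]]] j3].
- by rewrite (_ : Ordinal j3 = tape0); [case: run_of_input|apply: val_inj].
- by rewrite (_ : Ordinal j3 = tape1); [case: run_of_oracle|apply: val_inj].
- by rewrite (_ : Ordinal j3 = tape2); [exact: run_of_output_infinite|apply: val_inj].
Qed.

End Run.

Lemma code_size_eq x x' y q : (forall i, i < q -> block_of x i = block_of x' i) ->
  code_size x y q = code_size x' y q.
Proof. by move=> xx'; apply: eq_bigr => i _; rewrite xx'. Qed.

(** Decoding goes block by block: if all earlier blocks agree, the two code words start at the same
    position of [z], so one is a prefix of the other and the blocks agree. *)
Lemma block_compressor_compressor : compressor C.
Proof.
split=> [|y x x' z [r [racc [rx [ry rz]]]] [r' [racc' [rx' [ry' rz']]]]].
  exact: block_compressor_deterministic.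
have [inp rE] := accepting_run_of racc; have [inp' rE'] := accepting_run_of racc'.
rewrite {}rE {r racc} in rx ry rz; rewrite {}rE' {r' racc'} in rx' ry' rz'.
have xE := comp_is_uniq rx (run_of_input inp).
have xE' := comp_is_uniq rx' (run_of_input inp').
have yE := comp_is_uniq ry (run_of_oracle inp).
have yE' := comp_is_uniq ry' (run_of_oracle inp').
have xx' q : block_of x q = block_of x' q.
  elim/ltn_ind: q => q IHq.
  have := run_of_output q rz; have := run_of_output q rz'.
  rewrite -xE -xE' -yE -yE' (code_size_eq y IHq).
  set w := code _ (_ x _); set w' := code _ (_ x' _) => w'E wE.
  have pre m n : m <= n -> prefix (factor z (code_size x' y q) m)
      (factor z (code_size x' y q) n).
    move=> /subnKC <-; rewrite /factor /mkseq iotaD map_cat; exact: prefix_prefix.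
  have [/pre|/ltnW/pre] := leqP (size w) (size w'); rewrite wE w'E.
    exact: code_prefix.
  by move/code_prefix.
apply: funext => i.
have := congr1 (fun u : block => u (Ordinal (ltn_pmod i K0))) (xx' (i %/ K)).
by rewrite !ffunE /= -divn_eq.
Qed.

Lemma block_compressor_run x y : exists r : run C,
  [/\ accepting r, comp_is (comp r tape0) x, comp_is (comp r tape1) y &
  forall N, cnt (comp r tape0) (N * P) = N * K /\
            cnt (comp r tape2) (N * P) = code_size x y N].
Proof.
pose inp i := (x (i %/ P * K + i %% P), y (i %/ P * K + i %% P)).
have posE i : (i %/ K * P + i %% K) %/ P * K + (i %/ K * P + i %% K) %% P = i.
  have iP : i %% K < P by rewrite (leq_trans (ltn_pmod i K0))// leq_addr.
  by rewrite divnMDl// modnMDl (divn_small iP) (modn_small iP) addn0 -divn_eq.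
have [xE yE] : letters1 inp = x /\ letters2 inp = y.
  by split; apply: funext => i; rewrite /letters1 /letters2 /inp /= posE.
exists (run_of inp); split; first exact: run_of_accepting.
- by rewrite -[X in comp_is _ X]xE; exact: run_of_input.
- by rewrite -[X in comp_is _ X]yE; exact: run_of_oracle.
- move=> N; rewrite -[N * P]addn0 cnt0E// cnt_output// xE yE.
  by rewrite sub0n !min0n !addn0.
Qed.

Lemma rho_cond_le (R : realType) (x y : iword A) (th : R) :
  (forall N0, exists2 N, N0 <= N &
    ((code_size x y N)%:R <= th * (N * K)%:R)%R) -> (rho_cond R x y <= th%:E)%E.
Proof.
move=> h; have [r [racc rx ry rcnt]] := block_compressor_run x y.
apply: (@le_trans _ _ (rho_C R r)).
  apply: ereal_inf_lbound; exists C, r; split=> //.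
  exact: block_compressor_compressor.
apply: limn_einf_le => n0; have [N N0 NP] := h n0.+1.
exists (N * P); first by rewrite (leq_trans (ltnW N0))// leq_pmulr.
have [e0 e2] := rcnt N; rewrite /run_ratio e0 e2 lee_fin ler_pdivrMr//.
by rewrite ltr0n muln_gt0 K0 (leq_trans _ N0).
Qed.

End BlockCompressor.

(** * Joint block frequencies *)

Lemma card_le_injection (T U : finType) (S : {set T}) (u0 : U) :
  (#|S| <= #|U|)%N -> exists f : T -> U, {in S &, injective f}.
Proof.
move=> SU; exists (fun t => nth u0 (enum U) (index t (enum S))) => s t sS tS.
have ltU w : w \in S -> (index w (enum S) < size (enum U))%N.
  by move=> wS; rewrite -cardE (leq_trans _ SU)// cardE index_mem mem_enum.
move/eqP; rewrite nth_uniq ?enum_uniq ?ltU// => /eqP st.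
by rewrite -(nth_index s (s := enum S) (x := s)) ?mem_enum// st nth_index ?mem_enum.
Qed.

Lemma prefix_size_eq (A : eqType) (s t : seq A) :
  size s = size t -> prefix s t -> s = t.
Proof. by move=> st; rewrite prefixE st take_size => /eqP. Qed.

(** The flag [a1] or [a0] determines the length of the code word, and among words of equal length a
    prefix is an equality. *)
Lemma two_length_code (A : finType) (K M : nat)
    (atyp : {ffun 'I_K -> A} -> {ffun 'I_K -> A} -> bool) :
  (1 < #|A|)%N -> (forall v, #|[set u | atyp v u]| <= #|A| ^ M)%N ->
  exists2 code : {ffun 'I_K -> A} -> {ffun 'I_K -> A} -> seq A,
    forall v u, size (code v u) = (if atyp v u then M.+1 else K.+1) &
    forall v u u', prefix (code v u) (code v u') -> u = u'.
Proof.
move=> /card_gt1P[a0 [a1 [_ _ a01]]] fewA.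
have /choice[f fP] : forall v, exists f : {ffun 'I_K -> A} -> M.-tuple A,
    {in [set u | atyp v u] &, injective f}.
  move=> v; apply: card_le_injection; first exact: [tuple of nseq M a0].
  by rewrite card_tuple.
exists (fun v u => if atyp v u then a1 :: f v u else a0 :: codom u) => [v u|v u u'].
  by case: ifP => _ /=; rewrite size_tuple ?card_ord.
case: ifP => au; case: ifP => au'; rewrite prefix_cons.
- rewrite eqxx /= => /prefix_size_eq; rewrite !size_tuple => /(_ erefl)/val_inj.
  by apply: fP; rewrite inE.
- by rewrite eq_sym (negbTE a01).
- by rewrite (negbTE a01).
- rewrite eqxx /= => /prefix_size_eq; rewrite !size_codom => /(_ erefl) uu'.
  by apply/ffunP => i; have/eq_in_map := uu'; apply; rewrite mem_enum.
Qed.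

(** * A second moment bound for sums of independent centred terms *)

Section Chebyshev.
Variables (R : realType) (B : finType) (m : nat) (g : 'I_m -> B -> R).
Hypothesis g0 : forall i, \sum_b g i b = 0.
Hypothesis g1 : forall i b, `|g i b| <= 1.

Lemma sum_ffun_orthogonal (i j : 'I_m) : i != j ->
  \sum_(U : {ffun 'I_m -> B}) g i (U i) * g j (U j) = 0.
Proof.
move=> ij.
(* Independence: the sum over all [U] of the product factors over the coordinates, and the factor at
   [i] is [\sum_b g i b = 0]. *)
pose F k b := (if k == i then g i b else 1) * (if k == j then g j b else 1).
rewrite (eq_bigr (fun U : {ffun 'I_m -> B} => \prod_k F k (U k))) => [|U _].
  rewrite -bigA_distr_bigA (bigD1 i)//= [X in X * _](_ : _ = 0) ?mul0r//.
  rewrite -[RHS](g0 i); apply: eq_bigr => b _.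
  by rewrite /F eqxx (negbTE ij) mulr1.
by rewrite /F big_split /= -!big_mkcond /= !big_pred1_eq.
Qed.

Lemma sum_ffun_sqr :
  \sum_(U : {ffun 'I_m -> B}) (\sum_i g i (U i)) ^+ 2 <= m%:R * (#|B| ^ m)%:R.
Proof.
under eq_bigr do rewrite expr2 big_distrlr /=.
rewrite exchange_big /= mulr_natl -[X in _ *+ X]card_ord -sumr_const.
apply: ler_sum => i _; rewrite exchange_big /= (bigD1 i)//= [X in _ + X]big1 => [|j ji].
  rewrite addr0 -[X in (_ ^ X)%N]card_ord -card_ffun -sumr_const.
  apply: ler_sum => U _; rewrite -expr2 -real_normK ?num_real//.
  by rewrite exprn_ile1.
by rewrite sum_ffun_orthogonal// eq_sym.
Qed.

(** Chebyshev's inequality for the uniform measure, without denominators: the variance is at most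
    [m] and the deviation is [d * m]. *)
Lemma few_deviations (d : R) : (0 < m)%N -> 0 < d ->
  d ^+ 2 * m%:R * #|[set U : {ffun 'I_m -> B} | d * m%:R <= `|\sum_i g i (U i)|]|%:R
    <= (#|B| ^ m)%:R.
Proof.
move=> m0 d0; have mr0 : 0 < m%:R :> R by rewrite ltr0n.
rewrite -(ler_pM2l mr0); apply: le_trans sum_ffun_sqr.
rewrite -sumr_const !mulr_sumr big_mkcond /=; apply: ler_sum => U _.
rewrite inE; case: ifP => [dU|_]; last exact: sqr_ge0.
rewrite -[leRHS]real_normK ?num_real// mulr1.
have -> : m%:R * (d ^+ 2 * m%:R) = (d * m%:R) ^+ 2 by ring.
by rewrite ler_sqr// nnegrE ?mulr_ge0// ltW.
Qed.

End Chebyshev.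

Lemma sum_blocks (V : nmodType) (F : nat -> V) m N :
  \sum_(i < N * m) F i = \sum_(q < N) \sum_(i < m) F (q * m + i)%N.
Proof.
elim: N => [|N IHN]; first by rewrite mul0n !big_ord0.
by rewrite mulSnr big_split_ord big_ord_recr /= -IHN.
Qed.

Section SubBlocks.
Variables (A : finType) (l m : nat).

Lemma cell_subproof (i : 'I_m) (j : 'I_l) : (i * l + j < m * l)%N.
Proof. by have := ltn_ord i; have := ltn_ord j; nia. Qed.

Definition subblocks (u : {ffun 'I_(m * l) -> A}) : {ffun 'I_m -> l.-tuple A} :=
  [ffun i => [tuple u (Ordinal (cell_subproof i j)) | j < l]].

Lemma subblocks_inj : injective subblocks.
Proof.
move=> u v uv; apply/ffunP => k.
have l0 : (0 < l)%N.
  by have := leq_ltn_trans (leq0n k) (ltn_ord k); rewrite muln_gt0 => /andP[].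
have kl : (k %/ l < m)%N by rewrite ltn_divLR.
move: uv => /ffunP/(_ (Ordinal kl)); rewrite !ffunE.
move=> uvk.
have := congr1 (fun t : l.-tuple A => tnth t (Ordinal (ltn_pmod k l0))) uvk.
rewrite !tnth_mktuple; set k' := Ordinal _.
by have -> : k' = k by apply: val_inj; rewrite /= -divn_eq.
Qed.

Lemma subblocks_block_of (x : iword A) q (i : 'I_m) :
  subblocks (block_of (m * l) x q) i = factor x ((q * m + i) * l) l :> seq A.
Proof.
rewrite ffunE /factor /mkseq -val_enum_ord -map_comp /=; apply: eq_map => j.
by rewrite /= ffunE /=; congr x; rewrite mulnDl mulnA addnA.
Qed.

End SubBlocks.

(** * Irregular pairs of blocks allow compression *)

Section Deviation.
Variables (R : realType) (A : finType) (x y : iword A) (l : nat).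
Hypotheses (A2 : (1 < #|A|)%N) (l0 : (0 < l)%N).
Variables u0 v0 : l.-tuple A.
Let c : R := #|A|%:R^-1 ^+ l.

(** For fixed [v] this is centred over uniform [u], as the Chebyshev bound requires. *)
Let gap (u v : seq A) : R := (v == v0)%:R * ((u == u0)%:R - c).

Let Ar : 1 < #|A|%:R :> R. Proof. by rewrite ltr1n. Qed.

Let c01 : 0 <= c <= 1.
Proof.
by rewrite exprn_ge0 ?invr_ge0//= exprn_ile1 ?invr_ge0// invf_le1 ?ltW// (lt_trans _ Ar).
Qed.

Let gap1 u v : `|gap u v| <= 1.
Proof.
rewrite normrM ger0_norm//; apply: mulr_ile1 => //; first by rewrite lern1 leq_b1.
by move/andP: c01 => [? ?]; rewrite ler_norml; case: (_ == _) => /=; lra.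
Qed.

Let gap0 v : \sum_(u : l.-tuple A) gap u v = 0.
Proof.
rewrite -mulr_sumr sumrB (bigD1 u0)//= eqxx big1 => [|u /negbTE]; last first.
  by rewrite -val_eqE /= => ->.
rewrite sumr_const card_tuple -[c *+ _]mulr_natr /c natrX -exprMn mulVf ?expr1n.
  by rewrite addr0 subrr mulr0.
by rewrite gt_eqF// (lt_trans _ Ar).
Qed.

Definition joint_deviation N : R := \sum_(i < N)
  (factor y (i * l) l == v0)%:R * ((factor x (i * l) l == u0)%:R - c).
Local Notation D := joint_deviation.

Let joint_deviation_near n k : `|D (n + k) - D n| <= k%:R.
Proof.
rewrite /D big_split_ord addrAC subrr add0r.
apply: le_trans (ler_norm_sum _ _ _) _.
apply: le_trans (ler_sum _ (fun i _ => gap1 _ _)) _.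
by rewrite sumr_const card_ord.
Qed.

Section Code.
Variables (d : R) (t m : nat).
Hypotheses (d0 : 0 < d) (m0 : (0 < m)%N) (tm : (t < m)%N).
Hypothesis (dm : (#|A| ^ t.+1)%:R <= d ^+ 2 * m%:R).
Let K := (m * l)%N.
Let Z (v u : {ffun 'I_K -> A}) : R :=
  \sum_(i < m) gap (subblocks u i) (subblocks v i).
Let atypical v u := d * m%:R <= `|Z v u|.
Let tK : (t < K)%N. Proof. by rewrite (leq_trans tm)// leq_pmulr. Qed.

(** Chebyshev bounds the count by [#|A| ^ K] over [d ^+ 2 * m], and [dm] makes the denominator at
    least [#|A| ^ t.+1]: an index needs [t.+1] letters fewer than the block. *)
Let few_atypical v : (#|[set u | atypical v u]| <= #|A| ^ (K - t.+1))%N.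
Proof.
have g0 (i : 'I_m) : \sum_(u : l.-tuple A) gap u (subblocks v i) = 0 by exact: gap0.
pose S := [set U : {ffun 'I_m -> l.-tuple A} |
  d * m%:R <= `|\sum_(i < m) gap (U i) (subblocks v i)|].
have hS : _ * #|S|%:R <= _ :=
  few_deviations g0 (fun i u => gap1 u (subblocks v i)) m0 d0.
have -> : #|[set u | atypical v u]| = #|(@subblocks A l m) @: [set u | atypical v u]|.
  by rewrite card_imset//; exact: subblocks_inj.
apply: (@leq_trans #|S|).
  apply: subset_leq_card; apply/fintype.subsetP => U /imsetP[u].
  by rewrite !inE => ? ->.
rewrite -(ler_nat R) -(ler_pM2l (_ : 0 < (#|A| ^ t.+1)%:R)).
  rewrite -[leRHS]natrM -expnD subnKC//; move: hS; rewrite card_tuple -expnM mulnC.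
  by apply: le_trans; rewrite ler_wpM2r.
by rewrite ltr0n expn_gt0 ltnW.
Qed.

(** Infinitely often a proportion at least [d] of the long blocks is atypical. The mean saving
    [d * t.+1 >= 2] outweighs the flag letter, leaving at most [K - 1] letters per block. *)
Lemma deviation_compresses : 2 <= d * t.+1%:R ->
  (forall N0, exists2 N, (N0 <= N)%N & d *+ 2 * (N * m)%:R <= `|D (N * m)|) ->
  exists2 th : R, th < 1 & (rho_cond R x y <= th%:E)%E.
Proof.
move=> dt hD; have [code size_code code_prefix] := two_length_code A2 few_atypical.
have [a0 _] : exists a0 : A, true by move/card_gt0P: (ltnW A2) => [a _]; exists a.
have K0 : (0 < K)%N by exact: leq_ltn_trans tK.
have Kr0 : 0 < K%:R :> R by rewrite ltr0n.
exists ((K%:R - 1) / K%:R); first by rewrite ltr_pdivrMr// mul1r ltrBlDr ltrDl.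
apply: (@rho_cond_le A a0 K K.+1 K0 code) => //.
- by move=> v u; rewrite size_code; case: ifP.
- by move=> v u; rewrite size_code; case: ifP => //; rewrite ltnS leq_subr.
move=> N0; have [N NN0 DN] := hD N0; exists N => //.
pose at_ q := atypical (block_of K y q) (block_of K x q).
have DE : D (N * m) = \sum_(q < N) Z (block_of K y q) (block_of K x q).
  rewrite /D (sum_blocks (fun i => gap (factor x (i * l) l) (factor y (i * l) l))).
  by apply: eq_bigr => q _; apply: eq_bigr => i _; rewrite !subblocks_block_of.
have mr0 : 0 < m%:R :> R by rewrite ltr0n.
(* Typical blocks contribute at most [d * m] each to a total of at least [2 * d * N * m]; atypical
   ones, contributing at most [m] each, make up the rest. *)
have atN : d * N%:R <= \sum_(q < N) (at_ q)%:R.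
  have : `|D (N * m)| <= \sum_(q < N) (m%:R * (at_ q)%:R + d * m%:R).
    rewrite DE; apply: le_trans (ler_norm_sum _ _ _) _; apply: ler_sum => q _.
    have [aq|aq] := boolP (at_ q); last first.
      by rewrite mulr0 add0r; apply: ltW; rewrite ltNge.
    rewrite mulr1 ler_wpDr// ?mulr_ge0// ?(ltW d0)//.
    apply: le_trans (ler_norm_sum _ _ _) _.
    apply: le_trans (ler_sum _ (fun i _ => gap1 _ _)) _.
    by rewrite sumr_const card_ord.
  rewrite big_split /= -mulr_sumr sumr_const card_ord -[_ *+ N]mulr_natr.
  move/(le_trans DN); rewrite natrM -mulr_natr => h.
  by rewrite -(ler_pM2l mr0); lra.
rewrite /code_size natr_sum.
have sizeE q : (size (code (block_of K y q) (block_of K x q)))%:R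
    = K%:R + 1 - t.+1%:R * (at_ q)%:R :> R.
  rewrite size_code -/(at_ q); case: (at_ q).
    by rewrite subnSK// natrB 1?ltnW// mulr1 -natr1; ring.
  by rewrite mulr0 subr0 natr1.
under eq_bigr do rewrite sizeE.
have -> : (K%:R - 1) / K%:R * (N * K)%:R = (K%:R - 1) * N%:R :> R.
  by rewrite natrM; field; rewrite gt_eqF.
rewrite sumrB sumr_const card_ord -mulr_sumr.
rewrite -[_ *+ N]mulr_natr.
have : t.+1%:R * (d * N%:R) <= t.+1%:R * \sum_(q < N) (at_ q)%:R by rewrite ler_wpM2l.
have : 2 * N%:R <= d * t.+1%:R * N%:R by rewrite ler_wpM2r.
lra.
Qed.

End Code.

Lemma joint_deviation_sublinear :
  normal R x -> rho_cond R x y = rho R x -> sublinear D.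
Proof.
(* A deviation above [e * n = 4 * d * n] keeps at least [2 * d * n] when [n] is rounded down to a
   multiple of [m], provided [m <= 2 * d * n]. *)
move=> nx rxy; apply: contrapT => /existsNP[e /not_implyP[e0 /forallNP De]].
pose d := e / 4; have d0 : 0 < d by rewrite divr_gt0.
pose t := Num.truncn (2 / d).
have dt : 2 <= d * t.+1%:R by rewrite mulrC -ler_pdivrMr// ltW// truncnS_gt.
pose m := maxn t.+1 (Num.truncn ((#|A| ^ t.+1)%:R / d ^+ 2)).+1.
have tm : (t < m)%N by exact: leq_maxl.
have dm : (#|A| ^ t.+1)%:R <= d ^+ 2 * m%:R.
  rewrite mulrC -ler_pdivrMr ?exprn_gt0// ltW//; apply: lt_le_trans (truncnS_gt _) _.
  by rewrite ler_nat leq_maxr.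
have m0 : (0 < m)%N by exact: leq_ltn_trans tm.
have [|th th1 thP] := deviation_compresses d0 m0 tm dm dt.
  move=> N0; pose n0 := maxn (m * N0) (Num.truncn (m%:R / (d *+ 2))).+1.
  have /existsNP[n /not_implyP[n0n /negP]] := De n0; rewrite -ltNge => Dn.
  move: n0n; rewrite geq_max => /andP[mN0 mn]; exists (n %/ m)%N.
    by rewrite leq_divRL// mulnC.
  have d20 : 0 < d *+ 2 by rewrite mulrn_wgt0.
  have mn' : m%:R <= d *+ 2 * n%:R.
    rewrite mulrC -ler_pdivrMr// ltW//; apply: lt_le_trans (truncnS_gt _) _.
    by rewrite ler_nat.
  have := joint_deviation_near (n %/ m * m) (n %% m); rewrite -divn_eq => nD.
  have nm : (n %% m)%:R <= m%:R :> R by rewrite ler_nat ltnW// ltn_pmod.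
  have nn : (n %/ m * m)%:R <= n%:R :> R by rewrite ler_nat leq_divM.
  have := ler_distD 0 (D n) (D (n %/ m * m)%N).
  have := ler_normB (D n - D (n %/ m * m)%N) (- D (n %/ m * m)%N).
  rewrite opprK subrK normrN => h _.
  have h2 : d *+ 2 * (n %/ m * m)%:R <= d *+ 2 * n%:R by rewrite ler_wpM2l// ltW.
  have ed : e = d *+ 4 by rewrite /d -mulr_natr; field.
  have Dn' : d *+ 2 * n%:R + d *+ 2 * n%:R < `|D n|.
    by apply: le_lt_trans Dn; rewrite ed; lra.
  lra.
(* The midpoint lies strictly above [th], yet is a lower bound for [rho R x]. *)
have h1 : (th + 1) / 2 < 1 by lra.
have := rho_ge A2 nx h1; rewrite -rxy => /le_trans/(_ thP).
by rewrite lee_fin; lra.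
Qed.

End Deviation.

(** * Blocks of the join *)

Section JoinBlocks.
Variable A : finType.
Implicit Types x y z : iword A.

Lemma factorD z i k l : factor z i (k + l) = factor z i k ++ factor z (i + k)%N l.
Proof.
rewrite /factor /mkseq iotaD map_cat add0n; congr (_ ++ _).
rewrite -[X in iota X](addn0 k) iotaDl -map_comp; apply: eq_map => j /=.
by congr z; exact: addnA.
Qed.

Lemma join_shift x y a k :
  join x y (a.*2 + k)%N = if odd k then y (a + k./2)%N else x (a + k./2)%N.
Proof. by rewrite /join oddD odd_double halfD odd_double doubleK. Qed.

(** As the length is even, every aligned block of the join starts with a letter of [x]; [u] and [v]
    collect the letters of [w] at even and odd positions. *)
Lemma join_block x y (w : seq A) l : size w = l.*2 ->
  exists u v : l.-tuple A, forall i,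
    (factor (join x y) (i * l.*2) l.*2 == w) =
    (factor y (i * l) l == v) && (factor x (i * l) l == u).
Proof.
case: l => [|l] wl.
  by exists [tuple], [tuple] => i; rewrite /factor /= (size0nil wl).
have [a0 _] : exists a0 : A, true by case: w wl => [//|a ? _]; exists a.
exists [tuple nth a0 w i.*2 | i < l.+1], [tuple nth a0 w i.*2.+1 | i < l.+1] => i.
have tupleE (f : nat -> A) : [tuple f i | i < l.+1] = mkseq f l.+1 :> seq A.
  by rewrite /= /mkseq -val_enum_ord -map_comp.
rewrite (tupleE (fun k => nth a0 w k.*2)) (tupleE (fun k => nth a0 w k.*2.+1)) -doubleMr.
apply/eqP/andP => [wE|[/eqP vE /eqP uE]].
  have joinE k : (k < l.+1.*2)%N -> nth a0 w k = join x y ((i * l.+1).*2 + k)%N.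
    by move=> kl; rewrite -wE nth_mkseq.
  by split; apply/eqP/eq_in_map => k; rewrite mem_iota add0n /= => kl;
    rewrite joinE ?ltn_Sdouble ?ltn_double// join_shift /= odd_double;
    rewrite ?uphalf_double ?doubleK.
apply: (@eq_from_nth _ a0); rewrite size_mkseq ?wl// => k kl.
have kl' : (k./2 < l.+1)%N by rewrite ltn_half_double.
rewrite nth_mkseq// join_shift -[in RHS](odd_double_half k); case: ifP => ok.
  by have := congr1 (nth a0 ^~ k./2) vE; rewrite !nth_mkseq.
by have := congr1 (nth a0 ^~ k./2) uE; rewrite !nth_mkseq.
Qed.

Variable R : realType.
Local Notation c l := (#|A|%:R^-1 ^+ l : R).

(** Write [c] for [#|A| ^ -l]. The deviation of the pair count from [c ^ 2 * N] is the joint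
    deviation plus [c] times the deviation of the count of [v] in [y]. *)
Lemma join_block_count x y (w : seq A) l : (1 < #|A|)%N -> (0 < l)%N ->
  size w = l.*2 -> normal R x -> normal R y -> rho_cond R x y = rho R x ->
  sublinear (fun N => (block_count (join x y) w N)%:R - c l.*2 * N%:R : R).
Proof.
move=> A2 l0 wl nx ny rxy; have [u [v uvE]] := join_block x y wl.
have := (normal_block_count R y).1 ny v; rewrite size_tuple => /(_ l0) sv.
apply: eq_sublinear (sublinearD (joint_deviation_sublinear A2 l0 u v nx rxy)
  (sublinearZ (c l) sv)) => N.
rewrite /joint_deviation /block_count wl size_tuple !natr_sum mulrBr mulr_sumr.
rewrite addrA -big_split /= -addnn exprD mulrA; congr (_ - _); apply: eq_bigr => i _.
by rewrite addnn uvE; case: (_ == _); case: (_ == _) => /=; ring.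
Qed.

(** Reaches odd lengths, whose aligned blocks in a join do not all begin with the same component: a
    block of length [l] is a half of a block of length [2l], so the counts are summed over the other
    half. *)
Lemma block_count_halve z l : (0 < #|A|)%N ->
  (forall w : seq A, size w = l.*2 ->
    sublinear (fun N => (block_count z w N)%:R - c l.*2 * N%:R : R)) ->
  forall u : seq A, size u = l ->
    sublinear (fun N => (block_count z u N)%:R - c l * N%:R : R).
Proof.
move=> A0 sz u ul.
pose F i : R := (factor z (i * l) l == u)%:R.
have A0r : #|A|%:R != 0 :> R by rewrite pnatr_eq0 -lt0n.
have sumE N : \sum_(i < N * 2) F i = \sum_(w : l.-tuple A)
    ((block_count z (u ++ w) N)%:R + (block_count z (w ++ u) N)%:R).
  rewrite sum_blocks big_split /=.
  under [in RHS]eq_bigr do rewrite /block_count natr_sum.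
  under [X in _ + X]eq_bigr do rewrite /block_count natr_sum.
  rewrite [X in _ = X + _]exchange_big [X in _ = _ + X]exchange_big -big_split /=.
  apply: eq_bigr => q _; rewrite 2!big_ord_recl big_ord0 addr0 addn0.
  have blockE (s t : seq A) : size s = l -> size t = l ->
      (factor z (q * size (s ++ t)) (size (s ++ t)) == s ++ t) =
      (factor z (q * 2 * l) l == s) && (factor z ((q * 2 + 1) * l) l == t).
    move=> sl tl; rewrite size_cat sl tl factorD eqseq_cat ?size_mkseq ?sl//.
    by congr ((factor z _ l == s) && (factor z _ l == t)); ring.
  have sum1 (s : seq A) (b : bool) : size s = l ->
      \sum_(w : l.-tuple A) ((b && (s == w))%:R : R) = b%:R.
    move=> sl; have slP : size s == l by apply/eqP.
    rewrite (bigD1 (Tuple slP))//= eqxx andbT big1 ?addr0// => w /negbTE.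
    by rewrite -val_eqE /= eq_sym => ->; rewrite andbF.
  congr (_ + _).
    by under eq_bigr do rewrite blockE ?size_tuple//; rewrite sum1 ?size_mkseq.
  under eq_bigr do rewrite blockE ?size_tuple// andbC.
  by rewrite sum1 ?size_mkseq.
have sG : sublinear (fun N => \sum_(i < N * 2) F i - c l * (N * 2)%:R).
  pose G (w : l.-tuple A) N : R :=
    ((block_count z (u ++ w) N)%:R - c l.*2 * N%:R) +
    ((block_count z (w ++ u) N)%:R - c l.*2 * N%:R).
  apply: (@eq_sublinear _ (fun N => \sum_w G w N)) => [N|].
    rewrite sumE /G; under eq_bigr do rewrite addrACA -opprD.
    rewrite sumrB sumr_const card_tuple -addnn exprD; congr (_ - _).
    rewrite -[_ *+ (_ ^ _)]mulr_natr natrX natrM exprVn; field.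
    by rewrite expf_neq0.
  by apply: sublinear_sum => w; apply: sublinearD; apply: sz;
    rewrite size_cat ul size_tuple addnn.
have c01 : 0 <= c l <= 1.
  by rewrite exprn_ge0 ?invr_ge0//= exprn_ile1 ?invr_ge0// invf_le1 ?ler1n ?ltr0n.
(* For odd [N], one last block is not part of a pair. *)
have h2 : sublinear (fun N => F (N %/ 2 * 2)%N *+ (N %% 2) - c l * (N %% 2)%:R).
  apply: (@bounded_sublinear _ _ 1) => N.
  have : (N %% 2 < 2)%N by exact: ltn_pmod.
  case: (N %% 2)%N => [|[|//]] _; first by rewrite mulr0n mulr0 subrr normr0.
  rewrite mulr1n mulr1 /F; case: (_ == _) => /=; move: c01 => /andP[? ?];
  by rewrite ler_norml; lra.
have h3 : sublinear (fun N => \sum_(i < N %/ 2 * 2) F i - c l * (N %/ 2 * 2)%:R).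
  apply: (sublinear_comp (h := fun N => (N %/ 2)%N) _ _ _ sG).
  - by move=> m n; exact: leq_div2r.
  - by move=> m; exists (m * 2)%N; rewrite mulnK.
  - by move=> n; exact: leq_div.
apply: eq_sublinear (sublinearD h3 h2) => N.
rewrite addrACA -opprD -mulrDr -natrD -divn_eq; congr (_ - _).
rewrite /block_count ul natr_sum -/F [in RHS](divn_eq N 2) big_split_ord /=.
congr (_ + _).
have : (N %% 2 < 2)%N by exact: ltn_pmod.
case: (N %% 2)%N => [|[|//]] _; first by rewrite big_ord0.
by rewrite big_ord1 addn0.
Qed.

End JoinBlocks.

Theorem theorem6 (R : realType) (A : finType) (x y : iword A) :
  normal R x -> normal R y -> fs_independent R x y -> normal R (join x y).
Proof.
move=> nx ny [rxy _]; have [A1|A2] := leqP #|A| 1.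
  suff -> : join x y = x by [].
  by apply: funext => n; have/card_le1_eqP := A1; apply.
apply/normal_block_count => u u0; apply: block_count_halve => // [|w wl].
  exact: ltnW.
exact: join_block_count.
Qed.
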